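(* Let $k$ be a field and $A$ a finite dimensional $k$-algebra. Suppose that $A$ has a local cellular system $\mathfrak{c}(\Lambda;I,J,D)$ which is full, i.e. $\mathrm{im}(\varphi_\lambda)=D(\lambda)$ for all $\lambda\in\Lambda$. Then $A$ is (left and right) standardly stratified of length $|\Lambda|$.
   Context: $k$-algebras are associative with identity; modules are left modules unless called right modules. An ideal $H$ of a finite dimensional algebra $B$ is a left (resp. right) standard stratifying ideal if $H=BeB$ for some idempotent $e\in B$ and $H$ is projective as a left (resp. right) $B$-module. $A$ is left (resp. right) standardly stratified of length $n$ if it has a chain of ideals $0=J_0\subset J_1\subset\cdots\subset J_n=A$ such that $J_i/J_{i-1}$ is a left (resp. right) standard stratifying ideal of $A/J_{i-1}$ for $i=1,\dots,n$. Cellular system. Let $A$ be a $k$-algebra and $\Lambda$ a poset. A cellular system $\mathfrak{c}=\mathfrak{c}(\Lambda;I,J,D)$ of $A$ consists of, for each $\lambda\in\Lambda$, nonempty index sets $I(\lambda),J(\lambda)$ and a $k$-algebra $D(\lambda)$ with 1, and for each $(i,j)\in I(\lambda)\times J(\lambda)$ an injective $k$-linear map (not necessarily an algebra homomorphism) $c^\lambda_{i,j}:D(\lambda)\to A$, such that: (a) $A=\bigoplus_{\lambda\in\Lambda}\bigoplus_{i\in I(\lambda),j\in J(\lambda)}c^\lambda_{i,j}(D(\lambda))$; (b) for all $a\in A$, $\lambda\in\Lambda$, $i\in I(\lambda)$, $j\in J(\lambda)$ and $x\in D(\lambda)$, $$a\,c^\lambda_{i,j}(x)\equiv\sum_{i'\in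 I(\lambda)}c^\lambda_{i',j}(f^\lambda_{i'}(a,i)x)\pmod{A^{>\lambda}},\qquad c^\lambda_{i,j}(x)\,a\equiv\sum_{j'\in J(\lambda)}c^\lambda_{i,j'}(x\,g^\lambda_{j'}(j,a))\pmod{A^{>\lambda}},$$ where $f^\lambda_{i'}(a,i)\in D(\lambda)$ is independent of $j$ and $x$, $g^\lambda_{j'}(j,a)\in D(\lambda)$ is independent of $i$ and $x$ (all but finitely many terms being zero), and $A^{>\lambda}=\bigoplus_{\mu>\lambda}\bigoplus_{i\in I(\mu),j\in J(\mu)}c^\mu_{i,j}(D(\mu))$. Standard modules. $\Delta(\lambda)=\bigoplus_{i\in I(\lambda)}a^\lambda_i(D(\lambda))$, with $a_i^\lambda:D(\lambda)\to\Delta(\lambda)$ injective $k$-linear maps, is the $A$-$D(\lambda)$-bimodule with $a\cdot a^\lambda_i(x)=\sum_{i'}a^\lambda_{i'}(f^\lambda_{i'}(a,i)x)$ and $a^\lambda_i(x)\cdot y=a^\lambda_i(xy)$. $\Delta^{\mathrm{op}}(\lambda)=\bigoplus_{j\in J(\lambda)}b^\lambda_j(D(\lambda))$, with $b_j^\lambda:D(\lambda)\to\Delta^{\mathrm{op}}(\lambda)$ injective $k$-linear maps, is the $D(\lambda)$-$A$-bimodule with $b^\lambda_j(x)\cdot a=\sum_{j'}b^\lambda_{j'}(x\,g^\lambda_{j'}(j,a))$ and $y\cdot b^\lambda_j(x)=b^\lambda_j(yx)$. The map $\varphi_\lambda$. For $j\in J(\lambda)$, $i'\in I(\lambda)$ there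 is a unique $f^\lambda(j,i')\in D(\lambda)$ (independent of $i,j'$) with $c^\lambda_{i,j}(1)c^\lambda_{i',j'}(1)\equiv c^\lambda_{i,j'}(f^\lambda(j,i'))\pmod{A^{>\lambda}}$ for all $i\in I(\lambda)$, $j'\in J(\lambda)$. The map $\varphi_\lambda:\Delta^{\mathrm{op}}(\lambda)\otimes_A\Delta(\lambda)\to D(\lambda)$ is the $D(\lambda)$-$D(\lambda)$-bimodule homomorphism with $\varphi_\lambda(b^\lambda_j(x)\otimes a^\lambda_i(y))=x f^\lambda(j,i)y$. The cellular system is local if every $D(\lambda)$ is a local ring (not necessarily commutative). *)

(* Defs.v *)
From HB Require Import structures.
From mathcomp Require Import all_boot all_order all_algebra.
From mathcomp Require Import boolp classical_sets cardinality.
From mathcomp Require Import finmap monalg.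

Set Implicit Arguments.
Unset Strict Implicit.
Unset Printing Implicit Defensive.

Import Order.TTheory GRing.Theory.
Local Open Scope ring_scope.
Local Open Scope quotient_scope.

HB.mixin Record isIdeal (R : pzRingType) (S : {pred R}) := {
  ideal_mull : forall a x, x \in S -> a * x \in S;
  ideal_mulr : forall a x, x \in S -> x * a \in S
}.

#[short(type="idealType")]
HB.structure Definition Ideal (R : pzRingType) :=
  {S of isIdeal R S & GRing.ZmodClosed R S}.

Arguments ideal_mull {R s} a {x}.
Arguments ideal_mulr {R s} a {x}.

(* ring_quotient.v only puts a ring structure on {ideal_quot K} when R is
   commutative; the quotient may be the zero ring, hence pzRingType. *)
Section QuotientRing.
Variables (R : pzRingType) (K : idealType R).

Definition quotr := {ideal_quot K}.
HB.instance Definition _ := GRing.Zmodule.on quotr.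
HB.instance Definition _ := EqQuotient.on quotr.

Definition quotr_one : quotr := \pi_quotr (1 : R).
Definition quotr_mul (x y : quotr) : quotr :=
  \pi_quotr (repr x * repr y : R).

Lemma quotr_eq (x y : R) : (\pi_quotr x == \pi_quotr y) = (x - y \in K).
Proof. by rewrite (Quotient.idealrBE K). Qed.

Lemma quotr_piM (x y : R) :
  quotr_mul (\pi_quotr x) (\pi_quotr y) = \pi_quotr (x * y).
Proof.
have reprB z : repr (\pi_quotr z) - z \in K by rewrite -quotr_eq reprK.
apply/eqP; rewrite quotr_eq.
set x' := repr _; set y' := repr _.
have -> : x' * y' - x * y = (x' - x) * y' + x * (y' - y).
  by rewrite mulrBl mulrBr addrA subrK.
apply: rpredD; [apply: ideal_mulr | apply: ideal_mull]; exact: reprB.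
Qed.

Lemma quotr_piD (x y : R) : \pi_quotr x + \pi_quotr y = \pi_quotr (x + y).
Proof. by rewrite [RHS]raddfD. Qed.

Fact quotr_mulA : associative quotr_mul.
Proof.
elim/quotW=> x; elim/quotW=> y; elim/quotW=> z.
by rewrite (quotr_piM x y) (quotr_piM y z) 2!quotr_piM mulrA.
Qed.

Fact quotr_mul1 : left_id quotr_one quotr_mul.
Proof. by elim/quotW=> x; rewrite quotr_piM mul1r. Qed.

Fact quotr_mulr1 : right_id quotr_one quotr_mul.
Proof. by elim/quotW=> x; rewrite quotr_piM mulr1. Qed.

Fact quotr_mulDl : left_distributive quotr_mul +%R.
Proof.
elim/quotW=> x; elim/quotW=> y; elim/quotW=> z.
by rewrite (quotr_piM x z) (quotr_piM y z) !quotr_piD quotr_piM mulrDl.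
Qed.

Fact quotr_mulDr : right_distributive quotr_mul +%R.
Proof.
elim/quotW=> x; elim/quotW=> y; elim/quotW=> z.
by rewrite (quotr_piM x y) (quotr_piM x z) !quotr_piD quotr_piM mulrDr.
Qed.

HB.instance Definition _ := GRing.Zmodule_isPzRing.Build quotr
  quotr_mulA quotr_mul1 quotr_mulr1 quotr_mulDl quotr_mulDr.

Variable H : idealType R.

(* The image of H in R / K, i.e. H / K when K is contained in H. *)
Definition quot_ideal : {pred quotr} :=
  [pred y | `[< exists2 x, x \in H & y = \pi_quotr x >]].

Lemma quot_idealP y :
  reflect (exists2 x, x \in H & y = \pi_quotr x) (y \in quot_ideal).
Proof. exact: asboolP. Qed.

Fact quot_ideal_zmod_closed : zmod_closed quot_ideal.
Proof.
split=> [|_ _ /quot_idealP[x Hx ->] /quot_idealP[y Hy ->]]; apply/quot_idealP.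
  by exists 0; rewrite ?rpred0 // raddf0.
by exists (x - y); rewrite ?rpredB // [RHS]raddfB.
Qed.
HB.instance Definition _ :=
  GRing.isZmodClosed.Build quotr quot_ideal quot_ideal_zmod_closed.

Fact quot_ideal_mull (a y : quotr) : y \in quot_ideal -> a * y \in quot_ideal.
Proof.
elim/quotW: a => a /quot_idealP[x Hx ->]; apply/quot_idealP.
by exists (a * x); rewrite -?quotr_piM //; exact: ideal_mull.
Qed.

Fact quot_ideal_mulr (a y : quotr) : y \in quot_ideal -> y * a \in quot_ideal.
Proof.
elim/quotW: a => a /quot_idealP[x Hx ->]; apply/quot_idealP.
by exists (x * a); rewrite -?quotr_piM //; exact: ideal_mulr.
Qed.
HB.instance Definition _ :=
  isIdeal.Build quotr quot_ideal quot_ideal_mull quot_ideal_mulr.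

End QuotientRing.
Arguments quot_ideal {R} K H _.

(* Right modules over B are left modules over the converse ring B^c. *)
Section IdealModules.
Variables (B : pzRingType) (H : idealType B).

Definition left_ideal_mod := {x : B | x \in H}.
HB.instance Definition _ := SubChoice.on left_ideal_mod.
HB.instance Definition _ := [SubChoice_isSubZmodule of left_ideal_mod by <:].

Definition left_ideal_scale (b : B) (x : left_ideal_mod) : left_ideal_mod :=
  exist _ (b * val x) (ideal_mull b (valP x)).

Fact left_ideal_scaleA a b x :
  left_ideal_scale a (left_ideal_scale b x) = left_ideal_scale (a * b) x.
Proof. by apply: val_inj; rewrite /= mulrA. Qed.
Fact left_ideal_scale1 : left_id 1 left_ideal_scale.
Proof. by move=> x; apply: val_inj; rewrite /= mul1r. Qed.
Fact left_ideal_scaleDr : right_distributive left_ideal_scale +%R.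
Proof. by move=> a x y; apply: val_inj; rewrite /= mulrDr. Qed.
Fact left_ideal_scaleDl x : {morph left_ideal_scale^~ x : a b / a + b}.
Proof. by move=> a b; apply: val_inj; rewrite /= mulrDl. Qed.
HB.instance Definition _ := GRing.Zmodule_isLmodule.Build B left_ideal_mod
  left_ideal_scaleA left_ideal_scale1 left_ideal_scaleDr left_ideal_scaleDl.

Definition right_ideal_mod := {x : B | x \in H}.
HB.instance Definition _ := SubChoice.on right_ideal_mod.
HB.instance Definition _ := [SubChoice_isSubZmodule of right_ideal_mod by <:].

Definition right_ideal_scale (b : B^c) (x : right_ideal_mod) : right_ideal_mod :=
  exist _ (val x * (b : B)) (@ideal_mulr B H b _ (valP x)).

Fact right_ideal_scaleA a b x :
  right_ideal_scale a (right_ideal_scale b x) = right_ideal_scale (a * b) x.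
Proof. by apply: val_inj; rewrite /= mulrA. Qed.
Fact right_ideal_scale1 : left_id 1 right_ideal_scale.
Proof. by move=> x; apply: val_inj; rewrite /= mulr1. Qed.
Fact right_ideal_scaleDr : right_distributive right_ideal_scale +%R.
Proof. by move=> a x y; apply: val_inj; rewrite /= mulrDl. Qed.
Fact right_ideal_scaleDl x : {morph right_ideal_scale^~ x : a b / a + b}.
Proof. by move=> a b; apply: val_inj; rewrite /= mulrDr. Qed.
HB.instance Definition _ := GRing.Zmodule_isLmodule.Build B^c right_ideal_mod
  right_ideal_scaleA right_ideal_scale1 right_ideal_scaleDr right_ideal_scaleDl.

End IdealModules.

Definition projective (R : pzRingType) (P : lmodType R) : Prop :=
  forall (M N : lmodType R) (p : {linear M -> N}) (f : {linear P -> N}),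
    (forall y, exists x, p x = y) ->
    exists g : {linear P -> M}, forall x, p (g x) = f x.

Definition idempotent_ideal (B : pzRingType) (H : idealType B) : Prop :=
  exists2 e : B, e * e = e &
    forall x : B, x \in H <->
      exists s : seq (B * B), x = \sum_(p <- s) p.1 * e * p.2.

Definition left_standard_stratifying (B : pzRingType) (H : idealType B) : Prop :=
  idempotent_ideal H /\ projective (left_ideal_mod H).

Definition right_standard_stratifying (B : pzRingType) (H : idealType B) : Prop :=
  idempotent_ideal H /\ projective (right_ideal_mod H).

(* For algebras, two-sided ring ideals are automatically k-subspaces, so only
   the ring structure matters; the inclusions in the chain are strict. *)
Definition stratified_by (stratifying : forall B : pzRingType, idealType B -> Prop)
    (A : pzRingType) (n : nat) : Prop :=
  exists J : nat -> idealType A,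
    [/\ forall x, (x \in J 0) = (x == 0),
        forall x, x \in J n
      & forall i, (i < n)%N ->
          [/\ {subset J i <= J i.+1},
              exists2 x, x \in J i.+1 & x \notin J i
            & stratifying (quotr (J i)) (quot_ideal (J i) (J i.+1))]].

Definition left_standardly_stratified :=
  stratified_by left_standard_stratifying.
Definition right_standardly_stratified :=
  stratified_by right_standard_stratifying.

Section MalgSum.
Variables (K : choiceType) (G H : zmodType).

(* The additive map {malg G[K]} -> H given by h k on the copy of G at k. *)
Definition msum (h : K -> G -> H) (v : {malg G[K]}) : H :=
  \sum_(k <- msupp v) h k v@_k.

Variable h : K -> G -> H.
Hypothesis hB : forall k, zmod_morphism (h k).

Let h0 k : h k 0 = 0. Proof. by have := hB k 0 0; rewrite !subrr. Qed.

Lemma msumEw (d : {fset K}) (v : {malg G[K]}) : (msupp v `<=` d)%fset ->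
  msum h v = \sum_(k <- d) h k v@_k.
Proof.
move=> le_vd; rewrite /msum (big_fset_incl _ le_vd) // => k _ /mcoeff_outdom ->.
exact: h0.
Qed.

Lemma msumB : zmod_morphism (msum h).
Proof.
move=> u v; pose d := (msupp u `|` msupp v)%fset.
rewrite (@msumEw d (u - v)) ?msuppB_le // (@msumEw d u) ?fsubsetUl //.
rewrite (@msumEw d v) ?fsubsetUr // -sumrB; apply: eq_bigr => k _.
by rewrite mcoeffB hB.
Qed.

Lemma msum0 : msum h 0 = 0.
Proof. by have := msumB 0 0; rewrite !subrr. Qed.

Lemma msumN : {morph msum h : u / - u}.
Proof. by move=> u; rewrite -(sub0r u) msumB msum0 sub0r. Qed.

Lemma msumD : {morph msum h : u v / u + v}.
Proof. by move=> u v; rewrite -{1}(opprK v) msumB msumN opprK. Qed.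

Lemma msumU k x : msum h << x *g k >> = h k x.
Proof. by rewrite (msumEw msuppU_le) big_seq_fset1 mcoeffUU. Qed.

End MalgSum.

Lemma malg_ind (K : choiceType) (G : zmodType) (P : {malg G[K]} -> Prop) :
  P 0 -> (forall k x v, P v -> P (<< x *g k >> + v)) -> forall v, P v.
Proof.
move=> P0 PD v; rewrite (monalgE v); elim: (enum_fset _) => [|k s IHs].
  by rewrite big_nil.
by rewrite big_cons; apply: PD.
Qed.

Lemma zmod_morphD (G H : zmodType) (h : G -> H) :
  zmod_morphism h -> {morph h : x y / x + y}.
Proof.
move=> hB x y.
have h0 : h 0 = 0 by have := hB 0 0; rewrite !subrr.
have hN z : h (- z) = - h z by rewrite -(sub0r z) hB h0 sub0r.
by rewrite -{1}(opprK y) hB hN opprK.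
Qed.

Section Tensor.
Variables (R : pzRingType) (M : lmodType R^c) (N : lmodType R).

Definition tensor_free : zmodType := {malg int[(M * N)%type]}.
Definition tensor_gen (m : M) (n : N) : tensor_free := << 1 *g (m, n) >>.
Local Notation pt := tensor_gen.

(* The subgroup of the free abelian group on M * N generated by the relations
   of the tensor product; a right action m a is written a *: m, a : R^c. *)
Inductive tensor_rel : tensor_free -> Prop :=
| tensor_rel0 : tensor_rel 0
| tensor_relB u v : tensor_rel u -> tensor_rel v -> tensor_rel (u - v)
| tensor_relDl m m' n : tensor_rel (pt (m + m') n - (pt m n + pt m' n))
| tensor_relDr m n n' : tensor_rel (pt m (n + n') - (pt m n + pt m n'))
| tensor_relZ m (a : R) n :
    tensor_rel (pt ((a : R^c) *: m) n - pt m (a *: n)).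

Definition tensor_relb : {pred tensor_free} :=
  [pred u | `[< tensor_rel u >]].

Fact tensor_relb_zmod_closed : zmod_closed tensor_relb.
Proof.
split=> [|u v /asboolP ru /asboolP rv]; apply/asboolP.
  exact: tensor_rel0.
exact: tensor_relB.
Qed.
HB.instance Definition _ :=
  GRing.isZmodClosed.Build _ tensor_relb tensor_relb_zmod_closed.

Definition tensor := {ideal_quot tensor_relb}.
HB.instance Definition _ := GRing.Zmodule.on tensor.
HB.instance Definition _ := EqQuotient.on tensor.

Definition tens (m : M) (n : N) : tensor := \pi_tensor (pt m n).

Section Lift.
Variables (G : zmodType) (b : M -> N -> G).
Hypotheses (bDl : forall m m' n, b (m + m') n = b m n + b m' n)
           (bDr : forall m n n', b m (n + n') = b m n + b m n')
           (bZ : forall m (a : R) n, b ((a : R^c) *: m) n = b m (a *: n)).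

Let h (p : M * N) (z : int) : G := b p.1 p.2 *~ z.
Let h_zmod p : zmod_morphism (h p).
Proof. by move=> x y; rewrite /h mulrzBr. Qed.

Let free_lift : tensor_free -> G := msum h.
Let free_liftB u v : free_lift (u - v) = free_lift u - free_lift v.
Proof. exact: msumB. Qed.
Let free_liftD u v : free_lift (u + v) = free_lift u + free_lift v.
Proof. exact: msumD. Qed.
Let free_lift0 : free_lift 0 = 0.
Proof. exact: msum0. Qed.
Let free_lift_gen m n : free_lift (pt m n) = b m n.
Proof. exact: msumU. Qed.

Definition tensor_lift (t : tensor) : G := free_lift (repr t).

Fact tensor_lift_pi u : tensor_lift (\pi_tensor u) = free_lift u.
Proof.
have rel0 w : tensor_rel w -> free_lift w = 0.
  elim=> [|{}u v _ hu _ hv|m m' n|m n n'|m a n].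
  - exact: free_lift0.
  - by rewrite free_liftB hu hv subr0.
  - by rewrite free_liftB free_liftD !free_lift_gen bDl subrr.
  - by rewrite free_liftB free_liftD !free_lift_gen bDr subrr.
  - by rewrite free_liftB !free_lift_gen bZ subrr.
apply/eqP; rewrite -subr_eq0 -free_liftB; apply/eqP/rel0/asboolP.
have : repr (\pi_tensor u) = u %[mod tensor] by rewrite reprK.
by move/eqP; rewrite -(Quotient.idealrBE tensor_relb).
Qed.

Fact tensor_lift_is_zmod_morphism : zmod_morphism tensor_lift.
Proof.
elim/quotW=> u; elim/quotW=> v.
by rewrite -[_ - _](raddfB \pi_tensor) !tensor_lift_pi free_liftB.
Qed.

Lemma tensor_liftE m n : tensor_lift (tens m n) = b m n.
Proof. by rewrite tensor_lift_pi free_lift_gen. Qed.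

End Lift.
End Tensor.

(* Finite sums of elements c l i j x with l in P. *)
Inductive cell_sum (k : fieldType) (A : algType k) (Lam : Type)
    (I J : Lam -> Type) (D : Lam -> algType k)
    (c : forall l, I l -> J l -> {linear D l -> A}) (P : pred Lam) : A -> Prop :=
| cell_sum0 : cell_sum c P 0
| cell_sumD l i j x a :
    P l -> cell_sum c P a -> cell_sum c P (c l i j x + a).

Arguments cell_sum {k A Lam I J D} c P _.

(* The families f_i'(a, i) and g_j'(j, a), of which all but finitely many
   members vanish, are the finitely supported functions f a i and g j a. *)
Record cellular_system (k : fieldType) (A : algType k)
    (disp : Order.disp_t) (Lam : porderType disp) := CellularSystem {
  csI : Lam -> choiceType;
  csJ : Lam -> choiceType;
  csI_inh : forall l, inhabited (csI l);
  csJ_inh : forall l, inhabited (csJ l);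
  csD : Lam -> algType k;
  csc : forall l, csI l -> csJ l -> {linear csD l -> A};
  csc_inj : forall l (i : csI l) (j : csJ l), injective (csc i j);
  cs_span : forall a, cell_sum csc predT a;
  cs_direct :
    forall (s : seq {l : Lam & (csI l * csJ l)%type})
           (x : forall t : {l : Lam & (csI l * csJ l)%type}, csD (tag t)),
      uniq s ->
      \sum_(t <- s) csc (tagged t).1 (tagged t).2 (x t) = 0 ->
      forall t, t \in s -> csc (tagged t).1 (tagged t).2 (x t) = 0;
  csf : forall l, A -> csI l -> {malg (csD l)[csI l]};
  csg : forall l, csJ l -> A -> {malg (csD l)[csJ l]};
  cs_mull : forall (a : A) l (i : csI l) (j : csJ l) (x : csD l),
    cell_sum csc (fun m => (l < m)%O)
      (a * csc i j x
       - \sum_(i' <- msupp (csf a i)) csc i' j ((csf a i)@_i' * x));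
  cs_mulr : forall (a : A) l (i : csI l) (j : csJ l) (x : csD l),
    cell_sum csc (fun m => (l < m)%O)
      (csc i j x * a
       - \sum_(j' <- msupp (csg j a)) csc i j' (x * (csg j a)@_j'))
}.

Arguments csI {k A disp Lam} c l.
Arguments csJ {k A disp Lam} c l.
Arguments csD {k A disp Lam} c l.
Arguments csc {k A disp Lam} c l i j.
Arguments csf {k A disp Lam} c {l} a i.
Arguments csg {k A disp Lam} c {l} j a.

Section CellularTheory.
Variables (k : fieldType) (A : algType k).
Variables (disp : Order.disp_t) (Lam : porderType disp).
Variable S : cellular_system A Lam.

Local Notation I := (csI S).
Local Notation J := (csJ S).
Local Notation D := (csD S).
Local Notation c := (csc S _).
Local Notation cc := (csc S).
Local Notation f := (csf S).
Local Notation g := (csg S).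
Local Notation cell := {l : Lam & (I l * J l)%type}.

(* A^{> l} *)
Definition cs_above (l : Lam) : A -> Prop :=
  cell_sum cc (fun m => (l < m)%O).

Lemma cell_sumDD P a b :
  cell_sum cc P a -> cell_sum cc P b -> cell_sum cc P (a + b).
Proof.
move=> ha hb; elim: ha => [|l i j x {}a Pl _ ih]; first by rewrite add0r.
by rewrite -addrA; apply: cell_sumD.
Qed.

Lemma cell_sumN P a : cell_sum cc P a -> cell_sum cc P (- a).
Proof.
elim=> [|l i j x {}a Pl _ ih]; first by rewrite oppr0; exact: cell_sum0.
by rewrite opprD -linearN; apply: cell_sumD.
Qed.

Lemma cell_sumB P a b :
  cell_sum cc P a -> cell_sum cc P b -> cell_sum cc P (a - b).
Proof. by move=> ha hb; apply: cell_sumDD => //; apply: cell_sumN. Qed.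

Lemma cell_sum1 (P : pred Lam) l (i : I l) (j : J l) x :
  P l -> cell_sum cc P (c i j x).
Proof.
by move=> Pl; rewrite -[c _ _ _]addr0; apply: cell_sumD => //; apply: cell_sum0.
Qed.

Lemma cell_sum_sum P (T : Type) (s : seq T) (F : T -> A) :
  (forall t, cell_sum cc P (F t)) -> cell_sum cc P (\sum_(t <- s) F t).
Proof.
by move=> h; elim/big_ind: _ => //; [exact: cell_sum0 | exact: cell_sumDD].
Qed.

Lemma cell_sumW (P Q : pred Lam) a :
  (forall l, P l -> Q l) -> cell_sum cc P a -> cell_sum cc Q a.
Proof.
move=> PQ; elim=> [|l i j x {}a Pl _ ih]; first exact: cell_sum0.
by apply: cell_sumD => //; exact: PQ.
Qed.

Lemma cs_above_mull l a b : cs_above l b -> cs_above l (a * b).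
Proof.
elim=> [|m i j x {}b lm _ ih]; first by rewrite mulr0; exact: cell_sum0.
rewrite mulrDr; apply: cell_sumDD => //.
rewrite -(subrK (\sum_(i' <- msupp (f a i)) c i' j ((f a i)@_i' * x)) (a * _)).
apply: cell_sumDD.
  by apply: cell_sumW (cs_mull a i j x) => m' /(lt_trans lm).
by apply: cell_sum_sum => i'; exact: cell_sum1.
Qed.

Lemma cs_above_mulr l a b : cs_above l b -> cs_above l (b * a).
Proof.
elim=> [|m i j x {}b lm _ ih]; first by rewrite mul0r; exact: cell_sum0.
rewrite mulrDl; apply: cell_sumDD => //.
rewrite -(subrK (\sum_(j' <- msupp (g j a)) c i j' (x * (g j a)@_j')) (_ * a)).
apply: cell_sumDD.
  by apply: cell_sumW (cs_mulr a i j x) => m' /(lt_trans lm).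
by apply: cell_sum_sum => j'; exact: cell_sum1.
Qed.

Let cx (x : forall t : cell, D (tag t)) (t : cell) : A :=
  c (tagged t).1 (tagged t).2 (x t).

Lemma cell_sum_uniq (P : pred Lam) a : cell_sum cc P a ->
  exists s : seq cell, exists x : forall t : cell, D (tag t),
    [/\ uniq s, all (fun t => P (tag t)) s & a = \sum_(t <- s) cx x t].
Proof.
elim=> [|l i j y {}a Pl _ [s [x [us Ps ->]]]].
  by exists [::], (fun=> 0); rewrite big_nil.
pose t0 : cell := Tagged (fun l => I l * J l)%type (i, j).
pose dw (z : D l) : forall t : cell, D (tag t) :=
  @dfwith _ (fun t : cell => D (tag t)) x t0 z.
have dw_out z (t : cell) : t != t0 -> cx (dw z) t = cx x t.
  by move=> tt0; rewrite /cx /dw dfwith_out // eq_sym.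
have dw_in z : cx (dw z) t0 = c i j z by rewrite /cx /dw dfwith_in.
have [t0s|t0s] := boolP (t0 \in s); last first.
  exists (t0 :: s), (dw y); rewrite /= t0s us Pl Ps; split=> //.
  rewrite big_cons dw_in; congr (_ + _); apply: eq_big_seq => t ts.
  by rewrite dw_out //; apply: contraNneq t0s => <-.
exists s, (dw (y + x t0)); split=> //.
rewrite !(bigD1_seq t0 t0s us) /= dw_in linearD -addrA; congr (_ + (_ + _)).
by apply: eq_bigr => t tt0; rewrite dw_out.
Qed.

Let cell_fun (r : seq {t : cell & D (tag t)}) : uniq (map tag r) ->
  exists x : forall t : cell, D (tag t),
    forall p, p \in r -> x (tag p) = tagged p.
Proof.
elim: r => [_|[t0 y] r IHr /= /andP[t0r /IHr[x xE]]]; first by exists (fun=> 0).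
exists (@dfwith _ (fun t : cell => D (tag t)) x t0 y) => p.
rewrite inE => /predU1P[-> /=|pr]; first by rewrite dfwith_in.
by rewrite dfwith_out ?xE //; apply: contraNneq t0r => ->; apply: map_f.
Qed.

Lemma cs_above_free l (s : seq (I l * J l)) (y : I l * J l -> D l) :
  uniq s -> cs_above l (\sum_(p <- s) c p.1 p.2 (y p)) ->
  forall p, p \in s -> y p = 0.
Proof.
move=> us /cell_sum_uniq[s' [x [us' /allP above_s' eq_sum]]].
pose emb (p : I l * J l) : cell := Tagged (fun l => I l * J l)%type p.
have emb_inj : injective emb by move=> p q /eqP; rewrite eq_Tagged => /eqP.
pose ey p : {t : cell & D (tag t)} := existT (fun t : cell => D (tag t)) (emb p) (y p).
pose ex t : {t : cell & D (tag t)} := existT (fun t : cell => D (tag t)) t (- x t).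
pose r := map ey s ++ map ex s'.
have tag_r : map tag r = map emb s ++ s'.
  by rewrite /r map_cat -!map_comp [map (tag \o ex) _]map_id.
have us_r : uniq (map tag r).
  rewrite tag_r cat_uniq (map_inj_uniq emb_inj) us us' andbT /=.
  apply/hasPn => t /above_s' lt_lt; apply: contraL lt_lt => /mapP[p _ ->].
  by rewrite /= ltxx.
have [z zE] := cell_fun us_r.
have z_s p : p \in s -> z (emb p) = y p.
  by move=> ps; rewrite (zE (ey p)) // mem_cat map_f.
have z_s' t : t \in s' -> z t = - x t.
  by move=> ts; rewrite (zE (ex t)) // mem_cat (map_f ex) ?orbT.
have z0 : \sum_(t <- map tag r) cx z t = 0.
  rewrite tag_r big_cat big_map /=.
  under eq_big_seq => p ps do rewrite /cx z_s //.
  rewrite /= eq_sum -big_split big_seq big1 //= => t ts.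
  by rewrite /cx z_s' // linearN subrr.
move=> p ps; rewrite -z_s //.
apply: (@csc_inj _ _ _ _ S _ p.1 p.2); rewrite linear0.
by apply: (cs_direct us_r z0 (t := emb p)); rewrite tag_r mem_cat map_f.
Qed.

(* The elements sum_i c_ij(v_i) and sum_j c_ij(u_j) of A. *)
Definition lsum l (j : J l) (v : {malg (D l)[I l]}) : A :=
  msum (fun i x => c i j x) v.
Definition rsum l (i : I l) (u : {malg (D l)[J l]}) : A :=
  msum (fun j x => c i j x) u.

Let lsumB l (j : J l) : zmod_morphism (lsum j).
Proof. by apply: msumB => i x y; rewrite raddfB. Qed.
Let rsumB l (i : I l) : zmod_morphism (rsum i).
Proof. by apply: msumB => j x y; rewrite raddfB. Qed.
Let lsumD l (j : J l) := zmod_morphD (lsumB j).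
Let rsumD l (i : I l) := zmod_morphD (rsumB i).
Let lsum0 l (j : J l) : lsum j 0 = 0.
Proof. by have := lsumB j 0 0; rewrite !subrr. Qed.
Let rsum0 l (i : I l) : rsum i 0 = 0.
Proof. by have := rsumB i 0 0; rewrite !subrr. Qed.

Lemma lsumU l (i : I l) (j : J l) x : lsum j << x *g i >> = c i j x.
Proof. by rewrite /lsum msumU // => i' y z; rewrite raddfB. Qed.
Lemma rsumU l (i : I l) (j : J l) x : rsum i << x *g j >> = c i j x.
Proof. by rewrite /rsum msumU // => j' y z; rewrite raddfB. Qed.

Let psum_free l (z : {malg (D l)[(I l * J l)%type]}) :
  cs_above l (msum (fun p x => c p.1 p.2 x) z) -> z = 0.
Proof.
move=> az; apply/malgP => p; rewrite mcoeff0.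
have [pz|/mcoeff_outdom//] := boolP (p \in msupp z).
exact: (cs_above_free (y := mcoeff^~ z) (fset_uniq _) az).
Qed.

Let lsum_rsum_free l (i : I l) (j : J l) v u :
  cs_above l (lsum j v - rsum i u) ->
  v = << v@_i *g i >> /\ u = << v@_i *g j >>.
Proof.
pose zv := msum (fun i' x => << x *g (i', j) >>) v.
pose zu := msum (fun j' x => << x *g (i, j') >>) u.
have UB (K K' : choiceType) (e : K' -> K) (k' : K') :
    zmod_morphism (fun x : D l => << x *g e k' >>) by move=> x y; rewrite monalgUB.
have cB (p : I l * J l) : zmod_morphism (fun x : D l => c p.1 p.2 x).
  by move=> x y; rewrite raddfB.
have -> : lsum j v - rsum i u = msum (fun p x => c p.1 p.2 x) (zv - zu).
  rewrite (msumB cB); congr (_ - _); rewrite {}/zv {}/zu.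
    elim/malg_ind: v => [|i' x v IHv].
      by rewrite lsum0 msum0 ?msum0 //; exact: (UB _ _ (fun i => (i, j))).
    rewrite lsumD IHv (msumD (UB _ _ (fun i => (i, j)))) (msumD cB).
    by rewrite (msumU (UB _ _ (fun i => (i, j)))) (msumU cB) lsumU.
  elim/malg_ind: u => [|j' x u IHu].
    by rewrite rsum0 msum0 ?msum0 //; exact: (UB _ _ (fun j => (i, j))).
  rewrite rsumD IHu (msumD (UB _ _ (fun j => (i, j)))) (msumD cB).
  by rewrite (msumU (UB _ _ (fun j => (i, j)))) (msumU cB) rsumU.
move/psum_free => z0.
have zvE i' j' : zv@_(i', j') = v@_i' *+ (j == j').
  rewrite /zv; elim/malg_ind: v {zv z0} => [|i2 x v IHv].
    by rewrite msum0 ?mcoeff0 ?mul0rn //; exact: (UB _ _ (fun i => (i, j))).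
  rewrite (msumD (UB _ _ (fun i => (i, j)))) (msumU (UB _ _ (fun i => (i, j)))).
  by rewrite !mcoeffD IHv mulrnDl !mcoeffU -mulrnA mulnb xpair_eqE.
have zuE i' j' : zu@_(i', j') = u@_j' *+ (i == i').
  rewrite /zu; elim/malg_ind: u {zu z0} => [|j2 x u IHu].
    by rewrite msum0 ?mcoeff0 ?mul0rn //; exact: (UB _ _ (fun j => (i, j))).
  rewrite (msumD (UB _ _ (fun j => (i, j)))) (msumU (UB _ _ (fun j => (i, j)))).
  by rewrite !mcoeffD IHu mulrnDl !mcoeffU -mulrnA mulnb xpair_eqE andbC.
have vu i' j' : v@_i' *+ (j == j') = u@_j' *+ (i == i').
  by apply/eqP; rewrite -zvE -zuE -subr_eq0 -mcoeffB z0 mcoeff0.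
split; apply/malgP.
  move=> i'; rewrite mcoeffU; have := vu i' j; rewrite eqxx mulr1n => ->.
  by have := vu i j; rewrite !eqxx !mulr1n => ->.
by move=> j'; rewrite mcoeffU vu eqxx mulr1n.
Qed.

Lemma lsum_free l (j : J l) v : cs_above l (lsum j v) -> v = 0.
Proof.
have [i] := csI_inh S l; rewrite -[lsum _ _]subr0 -(rsum0 i).
case/lsum_rsum_free=> vE /(congr1 (mcoeff j)).
by rewrite mcoeffUU mcoeff0 => v0; rewrite vE -v0 monalgU0.
Qed.

Lemma rsum_free l (i : I l) u : cs_above l (rsum i u) -> u = 0.
Proof.
have [j] := csJ_inh S l => /cell_sumN; rewrite -sub0r -(lsum0 j).
by move=> /lsum_rsum_free[_ ->]; rewrite mcoeff0 monalgU0.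
Qed.

(* The element a_i(x) of Delta l is << x *g i >>. *)
Definition Delta l := {malg (D l)[I l]}.
HB.instance Definition _ l := GRing.Zmodule.on (Delta l).

Definition Delta_act l (a : A) (v : Delta l) : Delta l :=
  \sum_(i <- msupp v) \sum_(i' <- msupp (f a i)) << (f a i)@_i' * v@_i *g i' >>.

(* The element b_j(x) of Deltaop l is << x *g j >>. *)
Definition Deltaop l := {malg (D l)[J l]}.
HB.instance Definition _ l := GRing.Zmodule.on (Deltaop l).

Definition Deltaop_act l (a : A^c) (u : Deltaop l) : Deltaop l :=
  \sum_(j <- msupp u) \sum_(j' <- msupp (g j (a : A)))
     << u@_j * (g j (a : A))@_j' *g j' >>.

Let hl l (a : A) (i : I l) (x : D l) : Delta l :=
  \sum_(i' <- msupp (f a i)) << (f a i)@_i' * x *g i' >>.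
Let hlB l a (i : I l) : zmod_morphism (hl a i).
Proof.
move=> x y; rewrite /hl -sumrB; apply: eq_bigr => i' _.
by rewrite mulrBr monalgUB.
Qed.
Let hr l (a : A) (j : J l) (x : D l) : Deltaop l :=
  \sum_(j' <- msupp (g j a)) << x * (g j a)@_j' *g j' >>.
Let hrB l a (j : J l) : zmod_morphism (hr a j).
Proof.
move=> x y; rewrite /hr -sumrB; apply: eq_bigr => i' _.
by rewrite mulrBl monalgUB.
Qed.

Let Delta_actB l a : zmod_morphism (@Delta_act l a).
Proof. exact: (msumB (hlB a)). Qed.
Let Deltaop_actB l a : zmod_morphism (@Deltaop_act l a).
Proof. exact: (msumB (hrB a)). Qed.

Let Delta_act0 l a : @Delta_act l a 0 = 0.
Proof. exact: (msum0 (hlB a)). Qed.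
Let Deltaop_act0 l a : @Deltaop_act l a 0 = 0.
Proof. exact: (msum0 (hrB a)). Qed.

Lemma Delta_actU l a (i : I l) x : Delta_act a << x *g i >> =
  \sum_(i' <- msupp (f a i)) << (f a i)@_i' * x *g i' >>.
Proof. exact: (msumU (hlB a)). Qed.
Lemma Deltaop_actU l (a : A) (j : J l) x : Deltaop_act a << x *g j >> =
  \sum_(j' <- msupp (g j a)) << x * (g j a)@_j' *g j' >>.
Proof. exact: (msumU (hrB a)). Qed.

Lemma lsum_act l (j : J l) a v :
  cs_above l (a * lsum j v - lsum j (Delta_act a v)).
Proof.
elim/malg_ind: v => [|i x v IHv].
  rewrite lsum0 mulr0 Delta_act0 lsum0 subrr; exact: cell_sum0.
rewrite lsumD mulrDr (zmod_morphD (@Delta_actB l a)) lsumD opprD addrACA.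
apply: cell_sumDD => //; rewrite lsumU Delta_actU.
rewrite (big_morph _ (lsumD j) (lsum0 j)).
under [X in _ - X]eq_bigr do rewrite lsumU.
exact: cs_mull.
Qed.

Lemma rsum_act l (i : I l) (a : A) u :
  cs_above l (rsum i u * a - rsum i (Deltaop_act a u)).
Proof.
elim/malg_ind: u => [|j x u IHu].
  rewrite rsum0 mul0r Deltaop_act0 rsum0 subrr; exact: cell_sum0.
rewrite rsumD mulrDl (zmod_morphD (@Deltaop_actB l a)) rsumD opprD addrACA.
apply: cell_sumDD => //; rewrite rsumU Deltaop_actU.
rewrite (big_morph _ (rsumD i) (rsum0 i)).
under [X in _ - X]eq_bigr do rewrite rsumU.
exact: cs_mulr.
Qed.

Let Delta_act_uniq l (j : J l) a v w :
  cs_above l (a * lsum j v - lsum j w) -> Delta_act a v = w.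
Proof.
move=> h; apply/eqP; rewrite -subr_eq0; apply/eqP/(@lsum_free l j).
have := cell_sumB h (lsum_act j a v).
by rewrite opprB addrC -addrA addKr lsumB.
Qed.

Let Deltaop_act_uniq l (i : I l) (a : A) u w :
  cs_above l (rsum i u * a - rsum i w) -> Deltaop_act a u = w.
Proof.
move=> h; apply/eqP; rewrite -subr_eq0; apply/eqP/(@rsum_free l i).
have := cell_sumB h (rsum_act i a u).
by rewrite opprB addrC -addrA addKr rsumB.
Qed.

Fact Delta_actA l a b (v : Delta l) :
  Delta_act a (Delta_act b v) = Delta_act (a * b) v.
Proof.
have [j] := csJ_inh S l; apply/esym/(@Delta_act_uniq _ j).
have := cell_sumDD (cs_above_mull a (lsum_act j b v))
  (lsum_act j a (Delta_act b v)).
by rewrite mulrBr addrA subrK mulrA.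
Qed.
Fact Delta_act1 l : left_id 1 (@Delta_act l).
Proof.
move=> v; have [j] := csJ_inh S l; apply: (@Delta_act_uniq _ j).
by rewrite mul1r subrr; exact: cell_sum0.
Qed.
Fact Delta_actDr l : right_distributive (@Delta_act l) +%R.
Proof. by move=> a; exact: (zmod_morphD (@Delta_actB l a)). Qed.
Fact Delta_actDl l (v : Delta l) : {morph (@Delta_act l)^~ v : a b / a + b}.
Proof.
move=> a b; have [j] := csJ_inh S l; apply: (@Delta_act_uniq _ j).
rewrite lsumD mulrDl opprD addrACA.
exact: cell_sumDD (lsum_act _ _ _) (lsum_act _ _ _).
Qed.
HB.instance Definition _ l := GRing.Zmodule_isLmodule.Build A (Delta l)
  (@Delta_actA l) (@Delta_act1 l) (@Delta_actDr l) (@Delta_actDl l).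

Fact Deltaop_actA l (a b : A^c) (u : Deltaop l) :
  Deltaop_act a (Deltaop_act b u) = Deltaop_act (a * b) u.
Proof.
have [i] := csI_inh S l; apply/esym/(@Deltaop_act_uniq _ i).
have := cell_sumDD (cs_above_mulr a (rsum_act i b u))
  (rsum_act i a (Deltaop_act b u)).
by rewrite mulrBl addrA subrK -mulrA.
Qed.
Fact Deltaop_act1 l : left_id (1 : A^c) (@Deltaop_act l).
Proof.
move=> u; have [i] := csI_inh S l; apply: (@Deltaop_act_uniq _ i).
by rewrite mulr1 subrr; exact: cell_sum0.
Qed.
Fact Deltaop_actDr l : right_distributive (@Deltaop_act l) +%R.
Proof. by move=> a; exact: (zmod_morphD (@Deltaop_actB l a)). Qed.
Fact Deltaop_actDl l (u : Deltaop l) :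
  {morph (@Deltaop_act l)^~ u : a b / a + b}.
Proof.
move=> a b; have [i] := csI_inh S l; apply: (@Deltaop_act_uniq _ i).
rewrite rsumD mulrDr opprD addrACA.
exact: cell_sumDD (rsum_act _ _ _) (rsum_act _ _ _).
Qed.
HB.instance Definition _ l := GRing.Zmodule_isLmodule.Build A^c (Deltaop l)
  (@Deltaop_actA l) (@Deltaop_act1 l) (@Deltaop_actDr l) (@Deltaop_actDl l).

(* The d such that c_ij(1) c_i'j'(1) = c_ij'(d) modulo A^{> l} for all i, j';
   it exists and is unique by phi_coefP and phi_coef_uniq. *)
Definition phi_coef l (j : J l) (i' : I l) : D l :=
  xget 0 [set d : D l | forall (i : I l) (j' : J l),
    cs_above l (c i j 1 * c i' j' 1 - c i j' d)]%classic.

Let act_coef l (i : I l) (j : J l) (i' : I l) (j' : J l) :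
  Delta_act (c i j 1) << 1 *g i' >> =
    << (Delta_act (c i j 1) << 1 *g i' >>)@_i *g i >> /\
  Deltaop_act (c i' j' 1 : A) << 1 *g j >> =
    << (Delta_act (c i j 1) << 1 *g i' >>)@_i *g j' >>.
Proof.
apply: lsum_rsum_free.
have := cell_sumB (rsum_act i (c i' j' 1) << 1 *g j >>)
  (lsum_act j' (c i j 1) << 1 *g i' >>).
by rewrite lsumU rsumU opprB addrC addrA subrK.
Qed.

Lemma phi_coefP l (i : I l) (j : J l) (i' : I l) (j' : J l) :
  cs_above l (c i j 1 * c i' j' 1 - c i j' (phi_coef j i')).
Proof.
suff [d dP] : exists d : D l, forall i j',
    cs_above l (c i j 1 * c i' j' 1 - c i j' d).
  rewrite /phi_coef; case: xgetP => [_ _ /(_ i j')//|/(_ d)[]].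
  exact: dP.
exists (Deltaop_act (c i' j' 1 : A) << 1 *g j >>)@_j' => i1 j1.
have [_ e1] := act_coef i1 j i' j1.
have [_ e2] := act_coef i1 j i' j'.
rewrite e2 mcoeffUU -(rsumU i1 j1) -e1 -(rsumU i1 j 1).
exact: rsum_act.
Qed.

Lemma phi_coef_uniq l (j : J l) (i' : I l) (d : D l) :
  (forall i j', cs_above l (c i j 1 * c i' j' 1 - c i j' d)) ->
  d = phi_coef j i'.
Proof.
move=> dP; have [i] := csI_inh S l; have [j'] := csJ_inh S l.
have := cell_sumB (phi_coefP i j i' j') (dP i j').
rewrite opprB addrC addrA subrK -linearB -(lsumU i j') => /lsum_free.
move=> /(congr1 (mcoeff i)); rewrite mcoeffUU mcoeff0 => /eqP.
by rewrite subr_eq0 => /eqP.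
Qed.

Definition phi_pair l (u : Deltaop l) (v : Delta l) : D l :=
  \sum_(j <- msupp u) \sum_(i <- msupp v) u@_j * phi_coef j i * v@_i.

Let pB l (x : D l) (j : J l) (i : I l) :
  zmod_morphism (fun y : D l => x * phi_coef j i * y).
Proof. by move=> y z; rewrite mulrBr. Qed.
Let qB l (v : Delta l) (j : J l) :
  zmod_morphism (fun x : D l => msum (fun i y => x * phi_coef j i * y) v).
Proof.
by move=> x y; rewrite /msum -sumrB; apply: eq_bigr => i _; rewrite !mulrBl.
Qed.

Let phi_pairDl l (u u' : Deltaop l) v :
  phi_pair (u + u') v = phi_pair u v + phi_pair u' v.
Proof. exact: (msumD (qB v)). Qed.
Let phi_pairDr l (u : Deltaop l) v v' :
  phi_pair u (v + v') = phi_pair u v + phi_pair u v'.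
Proof.
rewrite /phi_pair -big_split; apply: eq_bigr => j _ /=.
exact: (msumD (pB u@_j j)).
Qed.
Let phi_pair0l l (v : Delta l) : phi_pair 0 v = 0.
Proof. exact: (msum0 (qB v)). Qed.
Let phi_pair0r l (u : Deltaop l) : phi_pair u 0 = 0.
Proof. by rewrite /phi_pair big1 // => j _; exact: (msum0 (pB u@_j j)). Qed.
Lemma phi_pairU l (i : I l) (j : J l) x y :
  phi_pair << x *g j >> << y *g i >> = x * phi_coef j i * y.
Proof.
by rewrite /phi_pair -(msumU (pB x j)); exact: (msumU (qB << y *g i >>)).
Qed.

Let Delta_act_mulr l a (i : I l) y :
  Delta_act a << y *g i >> =
  msum (fun i' x => << x * y *g i' >>) (Delta_act a << 1 *g i >>).
Proof.
have hB (i' : I l) : zmod_morphism (fun x : D l => << x * y *g i' >>).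
  by move=> z t; rewrite mulrBl monalgUB.
rewrite !Delta_actU (big_morph _ (msumD hB) (msum0 hB)).
by apply: eq_bigr => i' _; rewrite (msumU hB) mulr1.
Qed.
Let Deltaop_act_mull l (a : A) (j : J l) y :
  Deltaop_act a << y *g j >> =
  msum (fun j' x => << y * x *g j' >>) (Deltaop_act a << 1 *g j >>).
Proof.
have hB (j' : J l) : zmod_morphism (fun x : D l => << y * x *g j' >>).
  by move=> z t; rewrite mulrBr monalgUB.
rewrite !Deltaop_actU (big_morph _ (msumD hB) (msum0 hB)).
by apply: eq_bigr => i' _; rewrite (msumU hB) mul1r.
Qed.

Lemma csc_mul l (i : I l) (j : J l) x (i' : I l) (j' : J l) y :
  cs_above l (c i j x * c i' j' y - c i j' (x * phi_coef j i' * y)).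
Proof.
have hBl (i2 : I l) : zmod_morphism (fun x : D l => << x * y *g i2 >>).
  by move=> z t; rewrite mulrBl monalgUB.
have hBr (j2 : J l) : zmod_morphism (fun y : D l => << x * y *g j2 >>).
  by move=> z t; rewrite mulrBr monalgUB.
have Dop1 : Delta_act (c i j 1) << 1 *g i' >> = << phi_coef j i' *g i >>.
  by apply: (@Delta_act_uniq _ j'); rewrite !lsumU; exact: phi_coefP.
have Dop2 : Deltaop_act (c i' j' y : A) << 1 *g j >> =
    << phi_coef j i' * y *g j' >>.
  apply: (@Deltaop_act_uniq _ i); rewrite !rsumU.
  rewrite -(lsumU i' j') -(lsumU i j') -(msumU hBl) -Dop1 -Delta_act_mulr.
  exact: lsum_act.
rewrite -mulrA -(rsumU i j) -(rsumU i j') -(msumU hBr) -Dop2 -Deltaop_act_mull.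
exact: rsum_act.
Qed.

Let phi_pair_mul l (i : I l) (j : J l) u v :
  cs_above l (rsum i u * lsum j v - c i j (phi_pair u v)).
Proof.
elim/malg_ind: u => [|j1 x u IHu].
  by rewrite rsum0 mul0r phi_pair0l linear0 subrr; exact: cell_sum0.
rewrite rsumD mulrDl phi_pairDl linearD opprD addrACA.
apply: cell_sumDD => // {u IHu}; elim/malg_ind: v => [|i1 y v IHv].
  by rewrite lsum0 mulr0 phi_pair0r linear0 subrr; exact: cell_sum0.
rewrite lsumD mulrDr phi_pairDr linearD opprD addrACA.
apply: cell_sumDD => //; rewrite rsumU lsumU phi_pairU; exact: csc_mul.
Qed.

Let phi_pair_balanced l (u : Deltaop l) (a : A) (v : Delta l) :
  phi_pair ((a : A^c) *: u) v = phi_pair u (a *: v).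
Proof.
have [i] := csI_inh S l; have [j] := csJ_inh S l.
have h1 := cs_above_mulr (lsum j v) (rsum_act i a u).
have h2 := cs_above_mull (rsum i u) (lsum_act j a v).
have h3 := phi_pair_mul i j (Deltaop_act a u) v.
have h4 := phi_pair_mul i j u (Delta_act a v).
have e1 := cell_sumDD h1 h3; have e2 := cell_sumDD h2 h4.
rewrite mulrBl addrA subrK in e1; rewrite mulrBr addrA subrK mulrA in e2.
have := cell_sumB e2 e1; rewrite opprD opprK addrACA subrr add0r addrC.
rewrite -linearB -(lsumU i j) => /lsum_free /(congr1 (mcoeff i)).
by rewrite mcoeffUU mcoeff0 => /eqP; rewrite subr_eq0 => /eqP.
Qed.

(* The actions of D l on Delta l and Deltaop l play no role in forming the
   tensor product over A, and are not recorded; by phiE, phi is D l-linear on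
   both sides. *)
Definition phi l : tensor (Deltaop l) (Delta l) -> D l :=
  tensor_lift (@phi_pair l).

Fact phi_is_zmod_morphism l : zmod_morphism (@phi l).
Proof.
apply: tensor_lift_is_zmod_morphism.
- exact: phi_pairDl.
- exact: phi_pairDr.
- exact: phi_pair_balanced.
Qed.
HB.instance Definition _ l :=
  GRing.isZmodMorphism.Build (tensor (Deltaop l) (Delta l)) (D l) (@phi l)
    (@phi_is_zmod_morphism l).

Lemma phiE l (i : I l) (j : J l) (x y : D l) :
  phi (tens (<< x *g j >> : Deltaop l) (<< y *g i >> : Delta l)) =
  x * phi_coef j i * y.
Proof.
rewrite /phi tensor_liftE ?phi_pairU //.
- exact: phi_pairDl.
- exact: phi_pairDr.
- exact: phi_pair_balanced.
Qed.

End CellularTheory.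

Definition invertible (R : nzRingType) (x : R) : Prop :=
  exists y, x * y = 1 /\ y * x = 1.

(* In a nonzero ring, the noninvertible elements form an ideal as soon as they
   are closed under addition. *)
Definition local_ring (R : nzRingType) : Prop :=
  forall x y : R, ~ invertible x -> ~ invertible y -> ~ invertible (x + y).

Definition cs_local (k : fieldType) (A : algType k) (disp : Order.disp_t)
    (Lam : porderType disp) (S : cellular_system A Lam) : Prop :=
  forall l, local_ring (csD S l).

Definition cs_full (k : fieldType) (A : algType k) (disp : Order.disp_t)
    (Lam : porderType disp) (S : cellular_system A Lam) : Prop :=
  forall l (x : csD S l), exists t, phi t = x.

(* Main.v *)
Require Import Defs.
From HB Require Import structures.
From mathcomp Require Import all_boot all_order all_algebra all_field.
From mathcomp Require Import boolp classical_sets cardinality.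
From mathcomp Require Import finmap monalg.

Set Implicit Arguments.
Unset Strict Implicit.
Unset Printing Implicit Defensive.

Import Order.TTheory GRing.Theory.

Local Open Scope ring_scope.

(** Order the poset so that larger elements come first and let [J_i] be the span
    of the cells of the first [i] elements.  Multiplying an element of a cell by an
    element of [A] yields terms at the same element of the poset or at larger
    ones, so each [J_i] is an ideal, and passing from [J_i] to [J_(i+1)]
    adds exactly the cells of one element [l].  The dimension of [A] bounds the
    number of cells, because the images of [1] in distinct cells are linearly
    independent; hence the poset and the index sets are finite.

    In [B = A / J_i] the multiplication of the new layer [H = J_(i+1) / J_i] is
    [c_ij(x) c_i'j'(y) = c_ij'(x phi(j, i') y)].  Fullness writes [1] as a sum of
    products [x phi(j, i) y]; as [D l] is local, one of these is invertible, and
    then so is the coefficient [phi(j0, i0)] itself.  With [p] its inverse,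
    [e = c_i0j0(p)] is idempotent and
    [c_ij(x) = c_ij0(1) e c_i0j(p x)], so [H = B e B]
    ([full_local_phi_coef_invertible], [layer_idempotent]).

    As a left module, [H] is the direct sum, over the indices [j], of the columns
    [L_j = { sum_i c_ij(w_i) }].  Since the coefficients of the left action do
    not depend on [j], all columns are copies of the one standard module, so the
    map from column [j] to column [j0] is [B]-linear; and right multiplication
    by [u_j = c_i0j(p)] carries column [j0] back to column [j].  Thus
    [h = sum_j theta_j(h) u_j], where [theta_j] takes the column [j] of [h] into
    column [j0]: this is a dual basis, and [H] is projective.  The
    argument is isolated in [projective_copies], which applies to rows and the
    converse ring just as well, and so also proves projectivity on the right. *)

(** * Modules that are sums of copies *)

Lemma zmod_morph0 (G H : zmodType) (h : G -> H) : zmod_morphism h -> h 0 = 0.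
Proof. by move=> hB; have := hB 0 0; rewrite !subrr. Qed.

(** The copies span a set closed under adding one more term; this makes the
    spanning condition of [projective_copies] provable by induction on sums. *)
Lemma big_copies_add (R V : zmodType) (X : eqType) (s : seq X)
    (L : X -> V -> R) (j : X) (x : V) (w : X -> V) :
  (forall j, zmod_morphism (L j)) -> uniq s -> j \in s ->
  L j x + \sum_(j' <- s) L j' (w j') =
  \sum_(j' <- s) L j' (x *+ (j' == j) + w j').
Proof.
move=> LB us js.
under [RHS]eq_bigr do rewrite (zmod_morphD (LB _)).
rewrite big_split; congr (_ + _); rewrite (bigD1_seq j) //= eqxx.
by rewrite big1 ?addr0 // => i /negPf->; exact: zmod_morph0.
Qed.

(* [P] is a left ideal of [R], seen through [v]; it is the direct sum of the
   images of the [L j], on which [R] acts by a rule that is the same for all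
   [j], and [v (u j)] multiplies the copy at [x0] onto the copy at [j]. *)
Section Copies.
Variables (R : pzRingType) (P : lmodType R) (v : P -> R).
Variables (V : zmodType) (X : eqType) (s : seq X) (L : X -> V -> R).
Variables (x0 : X) (u : X -> P).
Hypothesis v_inj : injective v.
Hypothesis v_linear : forall b x y, v (b *: x + y) = b * v x + v y.
Hypothesis LB : forall j, zmod_morphism (L j).
Hypothesis L_span : forall x, exists w, v x = \sum_(j <- s) L j (w j).
Hypothesis L_free :
  forall w, \sum_(j <- s) L j (w j) = 0 -> {in s, forall j, w j = 0}.
Hypothesis L_act : forall b w, exists w', forall j, b * L j w = L j w'.
Hypothesis L_mul : forall w j, L x0 w * v (u j) = L j w.

(** The components [W x j] of [x] give functionals [x |-> L x0 (W x j)]: they are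
    linear because the action does not see [j].  Together with the elements [u j]
    they form a dual basis of [P]. *)
Lemma projective_copies : projective P.
Proof.
have [W WE] := choice L_span.
have [act actE] : exists act, forall b w j, b * L j w = L j (act b w).
  have act_ex b : exists h, forall w j, b * L j w = L j (h w).
    by have [h hE] := choice (L_act b); exists h.
  by have [act actE] := choice act_ex; exists act.
have LD j := zmod_morphD (LB j).
have W_uniq x w : v x = \sum_(j <- s) L j (w j) -> {in s, forall j, W x j = w j}.
  move=> xw j js; apply/eqP; rewrite -subr_eq0; apply/eqP.
  apply: (L_free (w := fun j => W x j - w j)) js.
  under eq_bigr do rewrite LB.
  by rewrite sumrB -WE xw subrr.
have W_linear b x y :
    {in s, forall j, W (b *: x + y) j = act b (W x j) + W y j}.
  apply: W_uniq; rewrite v_linear !WE mulr_sumr -big_split.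
  by apply: eq_bigr => j _; rewrite LD actE.
move=> M N p f p_surj.
have [m mE] := choice (fun j => p_surj (f (u j))).
pose g x := \sum_(j <- s) L x0 (W x j) *: m j.
have g_linear : linear g.
  move=> b x y; rewrite /g scaler_sumr -big_split !big_seq.
  by apply: eq_bigr => j js; rewrite W_linear // LD scalerDl -actE scalerA.
pose G : {linear P -> M} := HB.pack g (GRing.isLinear.Build R P M _ g g_linear).
exists G => x; rewrite [G x]/(g x) /g.
have v0 : v 0 = 0.
  have := v_linear 1 0 0; rewrite scale1r addr0 mul1r => /eqP.
  by rewrite -subr_eq0 opprD addrA subrr sub0r oppr_eq0 => /eqP.
have vZ b y : v (b *: y) = b * v y by rewrite -[b *: y]addr0 v_linear v0 addr0.
have vD : {morph v : y z / y + z}.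
  by move=> y z; rewrite -{1}[y]scale1r v_linear mul1r.
have {2}-> : x = \sum_(j <- s) L x0 (W x j) *: u j.
  apply: v_inj; rewrite (big_morph v vD v0) WE.
  by apply: eq_bigr => j _; rewrite vZ L_mul.
rewrite !linear_sum; apply: eq_bigr => j _.
by rewrite !linearZ /= mE.
Qed.

End Copies.

(** * Local rings *)

Section LocalRing.
Variable R : nzRingType.
Hypothesis R_local : local_ring R.

Lemma local_idempotent (e : R) : e * e = e -> e = 0 \/ e = 1.
Proof.
move=> ee.
have [[y [ey _]]|ne] := pselect (invertible e).
  by right; rewrite -[LHS]mulr1 -ey mulrA ee.
have [[y [_ ye]]|nf] := pselect (invertible (1 - e)).
  left; rewrite -[LHS]mul1r -ye -mulrA mulrBl mul1r ee subrr mulr0 //.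
have := R_local ne nf; rewrite addrC subrK; case.
by exists 1; rewrite mulr1.
Qed.

(** If [p q = 1] then [q p] is an idempotent, and a nonzero one; in a local ring
    it is [1].  So one-sided inverses, such as those of [a] that an inverse of
    [x a y] yields, are two-sided. *)
Lemma local_invertible_factor (x a y : R) :
  invertible (x * a * y) -> invertible a.
Proof.
have idem0 (p q : R) : p * q = 1 -> q * p = 1.
  move=> pq; have [|qp0|//] := @local_idempotent (q * p).
    by rewrite -mulrA (mulrA p) pq mul1r.
  have : p * (q * p) * q = 1 by rewrite mulrA pq mul1r pq.
  by rewrite qp0 mulr0 mul0r => /esym/eqP; rewrite oner_eq0.
case=> z [e1 e2]; exists (y * z * x); split.
  by rewrite !mulrA; apply: (idem0 x); rewrite -e1 !mulrA.
by rewrite -!mulrA; apply: (idem0 _ y); rewrite -e2 !mulrA.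
Qed.

Lemma local_noninvertible_zmod :
  zmod_closed [pred x : R | `[< ~ invertible x >]].
Proof.
split=> [|x y /asboolP nx /asboolP ny]; apply/asboolP.
  by case=> y [/eqP]; rewrite mul0r eq_sym oner_eq0.
apply: R_local => // -[z [e1 e2]]; apply: ny; exists (- z).
by rewrite mulrN -mulNr e1 mulNr -mulrN e2.
Qed.

End LocalRing.

(** * Independence of cells and invertible coefficients *)

Section Cells.
Variables (k : fieldType) (A : algType k).
Variables (disp : Order.disp_t) (Lam : porderType disp).
Variable S : cellular_system A Lam.

Local Notation I := (csI S).
Local Notation J := (csJ S).
Local Notation D := (csD S).
Local Notation c := (csc S _).
Local Notation cc := (csc S).
Local Notation cell := {l : Lam & (I l * J l)%type}.

(** The sum of all cells is direct, so cells at [l] stay independent modulo any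
    family of cells that avoids [l].  The layers of the chain are quotients by
    ideals that may be larger than the span of the cells above [l]. *)
Lemma cell_free (P : pred Lam) l (s : seq (I l * J l))
    (y : I l * J l -> D l) :
  ~~ P l -> uniq s -> cell_sum cc P (\sum_(p <- s) c p.1 p.2 (y p)) ->
  {in s, forall p, y p = 0}.
Proof.
move=> nPl us /cell_sum_uniq[s' [x [us' /allP Ps' eq_sum]]].
pose emb (p : I l * J l) : cell := Tagged (fun l => I l * J l)%type p.
have emb_inj : injective emb by move=> p q /eqP; rewrite eq_Tagged => /eqP.
(* One family of coefficients on all cells: [y] at the cells of [l], and the
   opposite of [x] elsewhere, so that the two expressions cancel. *)
pose z (t : cell) : D (tag t) :=
  match tag t =P l with
  | ReflectT e => ecast m (D m) (esym e)
                    (y (ecast m (I m * J m)%type e (tagged t)))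
  | ReflectF _ => - x t
  end.
have z_emb p : z (emb p) = y p.
  by rewrite /z; case: eqP => //= e; rewrite (eq_axiomK e).
have z_P t : P (tag t) -> z t = - x t.
  by move=> Pt; rewrite /z; case: eqP => // e; rewrite -e Pt in nPl.
have us_s' : uniq (map emb s ++ s').
  rewrite cat_uniq (map_inj_uniq emb_inj) us us' andbT /=.
  apply/hasPn => t /Ps' Pt; apply: contra nPl => /mapP[p _ tp].
  by rewrite tp in Pt.
have z0 : \sum_(t <- map emb s ++ s') c (tagged t).1 (tagged t).2 (z t) = 0.
  rewrite big_cat big_map /=; under eq_bigr do rewrite z_emb.
  rewrite eq_sum -big_split big_seq big1 //= => t /Ps' Pt.
  by rewrite z_P // linearN subrr.
move=> p ps; rewrite -z_emb; apply: (@csc_inj _ _ _ _ S _ p.1 p.2).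
rewrite linear0; apply: (cs_direct us_s' z0 (t := emb p)).
by rewrite mem_cat map_f.
Qed.

Lemma lsum_sum_free (P : pred Lam) l (s : seq (J l)) (w : J l -> Delta S l) :
  ~~ P l -> uniq s -> cell_sum cc P (\sum_(j <- s) lsum j (w j)) ->
  {in s, forall j, w j = 0}.
Proof.
move=> nPl us Pw j js; apply/malgP => i; rewrite mcoeff0.
have [iw|/mcoeff_outdom//] := boolP (i \in msupp (w j)).
pose r := [seq (i, j) | j <- s, i <- msupp (w j)].
apply: (@cell_free P l r (fun p => (w p.2)@_p.1) nPl _ _ (i, j)).
- apply: allpairs_uniq_dep => //.
  by move=> [j1 i1] [j2 i2] _ _ [-> ->].
- by rewrite /r big_allpairs_dep.
- by apply/allpairsPdep; exists j, i.
Qed.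

Lemma rsum_sum_free (P : pred Lam) l (s : seq (I l)) (w : I l -> Deltaop S l) :
  ~~ P l -> uniq s -> cell_sum cc P (\sum_(i <- s) rsum i (w i)) ->
  {in s, forall i, w i = 0}.
Proof.
move=> nPl us Pw i si; apply/malgP => j; rewrite mcoeff0.
have [jw|/mcoeff_outdom//] := boolP (j \in msupp (w i)).
pose r := [seq (i, j) | i <- s, j <- msupp (w i)].
apply: (@cell_free P l r (fun p => (w p.1)@_p.2) nPl _ _ (i, j)).
- apply: allpairs_uniq_dep => //.
  by move=> [i1 j1] [i2 j2] _ _ [-> ->].
- by rewrite /r big_allpairs_dep.
- by apply/allpairsPdep; exists i, j.
Qed.

(** Otherwise every [x phi(j, i) y] is noninvertible, and these elements generate
    the image of [phi]; noninvertible elements form a subgroup, which would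
    contain [1]. *)
Lemma full_local_phi_coef_invertible l :
  local_ring (D l) -> (exists t, phi t = 1 :> D l) ->
  exists j : J l, exists i : I l, invertible (phi_coef j i).
Proof.
move=> D_local [t t1]; apply: contrapT => ninv.
have [n0 nB] := local_noninvertible_zmod D_local.
pose N : {pred D l} := [pred x : D l | `[< ~ invertible x >]].
pose NZ := GRing.isZmodClosed.Build (D l) N (conj n0 nB).
pose NC : zmodClosed (D l) := HB.pack N NZ.
suff : phi t \in NC by move/asboolP; apply; rewrite t1; exists 1; rewrite mulr1.
rewrite /phi /tensor_lift /msum.
apply: rpred_sum => q _; apply: rpredMz; apply: rpred_sum => j _.
apply: rpred_sum => i _; apply/asboolP => /(local_invertible_factor D_local).
by move=> ji; apply: ninv; exists j, i.
Qed.

(** * The ideals spanned by cells *)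

Definition up_closed (P : pred Lam) : Prop :=
  forall l m, (l < m)%O -> P l -> P m.

(** The proof of up-closedness is an argument so that the ideal structure, which
    depends on it, can be inferred from the predicate. *)
Definition cell_ideal (P : pred Lam) (upP : up_closed P) : {pred A} :=
  [pred a | `[< cell_sum cc P a >]].

Section CellIdeal.
Variables (P : pred Lam) (upP : up_closed P).

Lemma cell_idealP a : reflect (cell_sum cc P a) (a \in cell_ideal upP).
Proof. exact: asboolP. Qed.

Fact cell_ideal_zmod_closed : zmod_closed (cell_ideal upP).
Proof.
split=> [|a b /cell_idealP Pa /cell_idealP Pb]; apply/cell_idealP.
  exact: cell_sum0.
exact: cell_sumB.
Qed.
HB.instance Definition _ :=
  GRing.isZmodClosed.Build A (cell_ideal upP) cell_ideal_zmod_closed.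

Lemma cs_above_ideal l a : P l -> cs_above S l a -> a \in cell_ideal upP.
Proof. by move=> Pl /cell_sumW h; apply/cell_idealP/h => m /upP; apply. Qed.

Lemma csc_ideal l (i : I l) (j : J l) x : P l -> c i j x \in cell_ideal upP.
Proof. by move=> Pl; apply/cell_idealP/cell_sum1. Qed.

Fact cell_ideal_mull a b : b \in cell_ideal upP -> a * b \in cell_ideal upP.
Proof.
move=> /cell_idealP; elim=> [|l i j x {}b Pl _ ih]; first by rewrite mulr0 rpred0.
rewrite mulrDr rpredD //.
rewrite -(rpredBr _ (cs_above_ideal Pl (cs_mull a i j x))) opprB addrC subrK.
by apply: rpred_sum => i' _; exact: csc_ideal.
Qed.

Fact cell_ideal_mulr a b : b \in cell_ideal upP -> b * a \in cell_ideal upP.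
Proof.
move=> /cell_idealP; elim=> [|l i j x {}b Pl _ ih]; first by rewrite mul0r rpred0.
rewrite mulrDl rpredD //.
rewrite -(rpredBr _ (cs_above_ideal Pl (cs_mulr a i j x))) opprB addrC subrK.
by apply: rpred_sum => j' _; exact: csc_ideal.
Qed.
HB.instance Definition _ :=
  isIdeal.Build A (cell_ideal upP) cell_ideal_mull cell_ideal_mulr.

End CellIdeal.

(** * The layer of one element of the poset *)

Lemma lsumB l (j : J l) : zmod_morphism (@lsum _ _ _ _ S l j).
Proof. by apply: msumB => i x y; rewrite raddfB. Qed.

Lemma rsumB l (i : I l) : zmod_morphism (@rsum _ _ _ _ S l i).
Proof. by apply: msumB => j x y; rewrite raddfB. Qed.

(* [K] is spanned by the cells in [P], and [H] is the quotient modulo [K] of the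
   ideal with the additional cells at [l].  What the multiplication rules leave
   unspecified lies in the cells above [l], hence in [K]. *)
Section Layer.
Variables (P Q : pred Lam) (upP : up_closed P) (upQ : up_closed Q) (l : Lam).
Hypotheses (nPl : ~~ P l) (lP : forall m, (l < m)%O -> P m).
Hypothesis QE : forall m, Q m = P m || (m == l).

Local Notation K := (cell_ideal upP : idealType A).
Local Notation B := (quotr K).
Local Notation H := (quot_ideal K (cell_ideal upQ)).
Local Notation pi a := (\pi_(quotr K)%qT (a : A) : B).

Let pi_eq a b : a - b \in K -> pi a = pi b.
Proof. by move=> ab; apply/eqP; rewrite quotr_eq. Qed.

Let pi_eq0 a : pi a = 0 -> cell_sum cc P a.
Proof.
move=> a0; apply/(cell_idealP upP); rewrite -[a]subr0 -quotr_eq a0.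
by rewrite raddf0.
Qed.

Let above_eq a b : cs_above S l (a - b) -> pi a = pi b.
Proof. by move=> ab; apply/pi_eq/cell_idealP/(cell_sumW _ ab). Qed.

Let piB : zmod_morphism (fun a => pi a).
Proof. by move=> a b; rewrite [LHS]raddfB. Qed.

Let piD a b : pi (a + b) = pi a + pi b.
Proof. exact: (zmod_morphD piB). Qed.

Let piM a b : pi a * pi b = pi (a * b).
Proof. exact: quotr_piM. Qed.

Let pi_csc_mul (i : I l) (j : J l) x (i' : I l) (j' : J l) y :
  pi (c i j x) * pi (c i' j' y) = pi (c i j' (x * phi_coef j i' * y)).
Proof. by rewrite piM; exact/above_eq/csc_mul. Qed.

Let csc_layer (i : I l) (j : J l) x : pi (c i j x) \in H.
Proof.
apply/quot_idealP; exists (c i j x) => //; apply: csc_ideal.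
by rewrite QE eqxx orbT.
Qed.

Lemma layer_ind (T : B -> Prop) : T 0 ->
  (forall (i : I l) (j : J l) x y, T y -> T (pi (c i j x) + y)) ->
  {in H, forall y, T y}.
Proof.
move=> T0 TD _ /quot_idealP[a /cell_idealP Qa ->].
elim: Qa => [|m i j x {}a Qm _ ih]; first by rewrite raddf0.
rewrite piD; move: Qm; rewrite QE => /orP[Pm|/eqP ml]; last first.
  by move: i j x; rewrite ml => i j x; apply: TD.
suff -> : pi (c i j x) = 0 by rewrite add0r.
by rewrite -(raddf0 (\pi_(quotr K)%qT)); apply: pi_eq; rewrite subr0 csc_ideal.
Qed.

Variables (j0 : J l) (i0 : I l) (p : D l).
Hypotheses (phi_p : phi_coef j0 i0 * p = 1) (p_phi : p * phi_coef j0 i0 = 1).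

(** [e = c_i0j0(p)] is idempotent as [p phi p = p], and every generator factors as
    [c_ij(x) = c_ij0(1) e c_i0j(p x)], since [phi p phi p x = x]. *)
Lemma layer_idempotent : idempotent_ideal H.
Proof.
exists (pi (c i0 j0 p)); first by rewrite pi_csc_mul p_phi mul1r.
move=> y; split=> [|[s ->]]; last first.
  apply: rpred_sum => q _; apply: ideal_mulr; apply: ideal_mull; exact: csc_layer.
move: y; apply: layer_ind => [|i j x y [s ->]]; first by exists [::]; rewrite big_nil.
exists ((pi (c i j0 1), pi (c i0 j (p * x))) :: s); rewrite big_cons /=.
by rewrite !pi_csc_mul mul1r phi_p mul1r mulrA phi_p mul1r.
Qed.

(** The copies are the columns [sum_i c_ij(w_i)], indexed by [j]. *)
Lemma layer_left_projective (s : seq (J l)) : uniq s -> (forall j, j \in s) ->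
  projective (left_ideal_mod H).
Proof.
move=> us s_full; pose L j (w : Delta S l) : B := pi (lsum j w).
have LB j : zmod_morphism (L j) by move=> v w; rewrite /L lsumB piB.
pose u j : left_ideal_mod H := exist _ (pi (c i0 j p)) (csc_layer i0 j p).
apply: (@projective_copies B (left_ideal_mod H) val (Delta S l) (J l) s L j0 u).
- exact: val_inj.
- by [].
- exact: LB.
- move=> y; move: (val y) (valP y); apply: layer_ind => [|i j x z [w ->]].
    by exists (fun=> 0); rewrite big1 // => j _; exact: zmod_morph0.
  exists (fun j' => << x *g i >> *+ (j' == j) + w j').
  by rewrite -big_copies_add // /L lsumU.
- move=> w; rewrite -(big_morph _ piD (raddf0 _)) => /pi_eq0.
  exact: lsum_sum_free.
- elim/quotW=> a w; exists (Delta_act a w) => j.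
  by rewrite /L piM; exact/above_eq/lsum_act.
- move=> w j; elim/malg_ind: w => [|i x w IHw].
    by rewrite !(zmod_morph0 (LB _)) mul0r.
  rewrite !(zmod_morphD (LB _)) mulrDl IHw; congr (_ + _).
  by rewrite /L !lsumU pi_csc_mul -mulrA phi_p mulr1.
Qed.

(** The copies are the rows [sum_j c_ij(w_j)], indexed by [i], over the converse
    ring. *)
Lemma layer_right_projective (s : seq (I l)) : uniq s -> (forall i, i \in s) ->
  projective (right_ideal_mod H).
Proof.
move=> us s_full; pose L i (w : Deltaop S l) : B^c := pi (rsum i w).
have LB i : zmod_morphism (L i) by move=> v w; rewrite /L rsumB piB.
pose u i : right_ideal_mod H := exist _ (pi (c i j0 p)) (csc_layer i j0 p).
apply: (@projective_copies B^c (right_ideal_mod H) val (Deltaop S l) (I l)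
          s L i0 u).
- exact: val_inj.
- by [].
- exact: LB.
- move=> y; move: (val y) (valP y); apply: layer_ind => [|i j x z [w ->]].
    by exists (fun=> 0); rewrite big1 // => i _; exact: zmod_morph0.
  exists (fun i' => << x *g j >> *+ (i' == i) + w i').
  by rewrite -big_copies_add // /L rsumU.
- move=> w; rewrite -(big_morph _ piD (raddf0 _)) => /pi_eq0.
  exact: rsum_sum_free.
- move=> b w; elim/quotW: b => a; exists (Deltaop_act a w) => i.
  by rewrite /L [LHS]piM; exact/above_eq/rsum_act.
- move=> w i; elim/malg_ind: w => [|j x w IHw].
    by rewrite !(zmod_morph0 (LB _)) mul0r.
  rewrite !(zmod_morphD (LB _)) mulrDl IHw; congr (_ + _).
  by rewrite /L !rsumU [LHS]pi_csc_mul p_phi mul1r.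
Qed.

End Layer.
End Cells.

(** * Finite-dimensional algebras *)

Section FiniteDimension.
Variables (k : fieldType) (A : falgType k).
Variables (disp : Order.disp_t) (Lam : porderType disp).
Variable S : cellular_system A Lam.
Local Notation cell := {l : Lam & (csI S l * csJ S l)%type}.

(** The images of [1] in distinct cells are linearly independent. *)
Lemma cells_bounded (s : seq cell) : uniq s -> (size s <= \dim {:A})%N.
Proof.
move=> us; pose b (t : cell) : A := csc S _ (tagged t).1 (tagged t).2 1.
suff : free (map b s).
  by rewrite /free size_map => /eqP <-; exact: dimvS (subvf _).
apply/(freeP (X := map_tuple b (in_tuple s))) => a a0 i.
pose t0 : cell := tnth (in_tuple s) i.
pose x (t : cell) : csD S (tag t) :=
  (if insub (index t s) is Some j then a j else 0) *: 1.
have xE (j : 'I_(size s)) : x (nth t0 s j) = a j *: 1.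
  by rewrite /x index_uniq // valK.
have ti : nth t0 s i \in s by rewrite mem_nth.
have h := cs_direct us _ ti; move/(_ x): h.
rewrite xE linearZ /= -[csc _ _ _ _ _]/(b (nth t0 s i)) => h.
have : a i *: b (nth t0 s i) == 0.
  apply/eqP/h; rewrite (big_nth t0) big_mkord -[RHS]a0; apply: eq_bigr => j _.
  by rewrite xE linearZ (nth_map t0).
rewrite scaler_eq0 => /orP[/eqP//|/eqP].
rewrite -(linear0 (csc S _ (tagged (nth t0 s i)).1 (tagged (nth t0 s i)).2)).
by move=> /csc_inj/eqP; rewrite oner_eq0.
Qed.

Lemma finite_of_cells (X : eqType) (e : X -> cell) : injective e ->
  exists s : seq X, uniq s /\ forall x, x \in s.
Proof.
move=> e_inj; apply: contrapT => no_full.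
have long n : exists2 s : seq X, uniq s & size s = n.
  elim: n => [|n [s us sn]]; first by exists [::].
  have [x xs] : exists x, x \notin s.
    apply: contrapT => nx; apply: no_full; exists s; split=> // x.
    by apply: contrapT => /negP xs; apply: nx; exists x.
  by exists (x :: s); rewrite /= ?xs ?sn.
have [s us ss] := long (\dim {:A}).+1.
have := @cells_bounded (map e s); rewrite (map_inj_uniq e_inj) size_map ss ltnn.
by move/(_ us).
Qed.

Lemma layer_stratifying (P Q : pred Lam) (upP : up_closed P)
    (upQ : up_closed Q) l :
  ~~ P l -> (forall m, (l < m)%O -> P m) ->
  (forall m, Q m = P m || (m == l)) ->
  local_ring (csD S l) -> (exists t, phi t = 1 :> csD S l) ->
  let K : idealType A := cell_ideal S upP in
  left_standard_stratifying (quot_ideal K (cell_ideal S upQ)) /\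
  right_standard_stratifying (quot_ideal K (cell_ideal S upQ)).
Proof.
move=> nPl lP QE D_local D_full.
have [j0 [i0 [p [phi_p p_phi]]]] :=
  full_local_phi_coef_invertible D_local D_full.
have idem := layer_idempotent upP upQ lP QE phi_p p_phi.
have [sI [usI sI_full]] : exists s : seq (csI S l),
    uniq s /\ forall i, i \in s.
  apply: (finite_of_cells
    (e := fun i => Tagged (fun l => csI S l * csJ S l)%type (i, j0))).
  by move=> i1 i2 /eqP; rewrite eq_Tagged => /eqP[].
have [sJ [usJ sJ_full]] : exists s : seq (csJ S l),
    uniq s /\ forall j, j \in s.
  apply: (finite_of_cells
    (e := fun j => Tagged (fun l => csI S l * csJ S l)%type (i0, j))).
  by move=> j1 j2 /eqP; rewrite eq_Tagged => /eqP[].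
split; split=> //.
- exact: (layer_left_projective nPl lP QE phi_p usJ sJ_full).
- exact: (layer_right_projective nPl lP QE p_phi usI sI_full).
Qed.

End FiniteDimension.

(** * Enumerating the poset from the top *)

(** Sorting by the number of elements above works, as this number strictly
    decreases along the order. *)
Lemma decreasing_enumeration (disp : Order.disp_t) (T : porderType disp)
    (s : seq T) :
  uniq s -> (forall x, x \in s) ->
  exists s' : seq T, [/\ uniq s', forall x, x \in s' &
    forall x y, (x < y)%O -> (index y s' < index x s')%N].
Proof.
move=> us s_full; pose h x := size [seq y <- s | (x < y)%O].
have hlt x y : (x < y)%O -> (h y < h x)%N.
  move=> xy; apply: (@uniq_leq_size _ (y :: [seq z <- s | (y < z)%O])).
    by rewrite /= filter_uniq // mem_filter ltxx.
  move=> z; rewrite inE !mem_filter s_full !andbT.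
  by move=> /predU1P[->//|]; exact: lt_trans.
pose e := relpre h leq.
have e_total : total e by move=> x y; exact: leq_total.
have e_trans : transitive e by move=> x y z; exact: leq_trans.
exists (sort e s); split=> [|x|x y xy]; rewrite ?sort_uniq ?mem_sort //.
rewrite ltnNge; apply: contraL (hlt _ _ xy) => xy_index; rewrite -leqNgt.
by apply: (sorted_leq_index e_trans _ (sort_sorted e_total s));
  rewrite ?mem_sort // => z; exact: leqnn.
Qed.

Local Open Scope card_scope.
Local Open Scope classical_set_scope.

Theorem theorem6p1 (k : fieldType) (A : falgType k)
    (disp : Order.disp_t) (Lam : porderType disp)
    (S : cellular_system A Lam) :
  cs_local S -> cs_full S ->
  exists n : nat,
    [/\ [set: Lam] #= `I_n,
        left_standardly_stratified A n
      & right_standardly_stratified A n].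
Proof.
move=> S_local S_full.
pose t0 l : csI S l * csJ S l :=
  (inhabited_witness (csI_inh S l), inhabited_witness (csJ_inh S l)).
have [s0 [us0 s0_full]] : exists s : seq Lam, uniq s /\ forall l, l \in s.
  apply: (finite_of_cells
    (e := fun l => Tagged (fun l => csI S l * csJ S l)%type (t0 l))).
  by move=> l m /(congr1 tag).
have [s [us s_full r_lt]] := decreasing_enumeration us0 s0_full.
pose r l := index l s.
have r_bound l : (r l < size s)%N by rewrite index_mem.
have r_inj : injective r by move=> l m; apply: index_inj.
have r_surj i : (i < size s)%N -> exists l, r l = i.
  rewrite /r; case: (s) us => // l s' us' i_s.
  by exists (nth l (l :: s') i); rewrite index_uniq.
pose P i : pred Lam := fun l => (r l < i)%N.
have upP i : up_closed (P i) by move=> l m /r_lt; exact: ltn_trans.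
pose Ki i : idealType A := cell_ideal S (upP i).
have K0 x : (x \in Ki 0) = (x == 0).
  apply/(cell_idealP S (upP 0))/eqP => [|->]; last exact: cell_sum0.
  by case.
have Kn x : x \in Ki (size s).
  apply/(cell_idealP S (upP _))/(cell_sumW _ (cs_span S x)) => l _.
  exact: r_bound.
have K_step i : (i < size s)%N ->
  [/\ {subset Ki i <= Ki i.+1}, exists2 x, x \in Ki i.+1 & x \notin Ki i,
     left_standard_stratifying (quot_ideal (Ki i) (Ki i.+1))
   & right_standard_stratifying (quot_ideal (Ki i) (Ki i.+1))].
  move=> /r_surj[l li].
  have nPl : ~~ P i l by rewrite /P li ltnn.
  have lP m : (l < m)%O -> P i m by move=> /r_lt; rewrite -/(r m) -/(r l) li.
  have QE m : P i.+1 m = P i m || (m == l).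
    by rewrite /P ltnS leq_eqVlt -li (inj_eq r_inj) orbC.
  have [] := layer_stratifying (upP i) (upP i.+1) nPl lP QE
    (S_local l) (S_full l 1%R).
  split=> //.
    move=> x /(cell_idealP S (upP i)) Px; apply/(cell_idealP S (upP i.+1)).
    by apply: cell_sumW Px => m; rewrite QE => ->.
  have [i0 j0] := t0 l; exists (csc S l i0 j0 1%R).
    by apply: csc_ideal; rewrite QE eqxx orbT.
  apply/(cell_idealP S (upP i)) => c1.
  have := @cell_free _ _ _ _ S (P i) l [:: (i0, j0)] (fun=> 1%R) nPl isT.
  rewrite big_seq1 => /(_ c1 (i0, j0)).
  by rewrite mem_head => /(_ isT)/eqP; rewrite oner_eq0.
exists (size s); split.
- apply/card_set_bijP; exists r; split=> [l _|l m _ _ /r_inj//|i /r_surj[l li]].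
    exact: r_bound.
  by exists l.
- by exists Ki; split=> // i /K_step[].
- by exists Ki; split=> // i /K_step[].
Qed.
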